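(* Let $D$ be the formal derivative with respect to the grammar $G\colon x\to xy,\ y\to xz,\ z\to zw,\ w\to xz$, and let $\mathrm{Gen}(y,t)=\sum_{n\ge0}D^n(y)\,t^n/n!$. Writing $\Delta=\sqrt{(w+y)^2-4xz}$, we have $$\mathrm{Gen}(y,t)=y+\frac{-2xz+2xz\,e^{t\Delta}}{w+y+\Delta-(w+y-\Delta)e^{t\Delta}},$$ as power series in $t$.
   Context: Let $x,y,z,w$ be commuting variables. The formal derivative $D$ is the linear operator on Laurent polynomials in $x,y,z,w$ with $D(uv)=uD(v)+vD(u)$, $D(c)=0$ for constants $c$, and $D(x)=xy$, $D(y)=xz$, $D(z)=zw$, $D(w)=xz$; $D^0$ is the identity. For a Laurent polynomial $u$, $\mathrm{Gen}(u,t)=\sum_{n\ge0}D^n(u)t^n/n!$. *)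

(* Defs.v *)
From HB Require Import structures.
From mathcomp Require Import all_boot all_order all_algebra finmap.
From mathcomp.multinomials Require Import monalg.
From mathcomp Require Import boolp.

Set Implicit Arguments.
Unset Strict Implicit.
Unset Printing Implicit Defensive.

Import GRing.Theory.
Local Open Scope ring_scope.

(* R[[t]]: the sequence of coefficients, with the Cauchy product. *)
Record fps (R : Type) := FPS { fps_coef : nat -> R }.

Bind Scope ring_scope with fps.

HB.instance Definition _ (R : Type) := gen_eqMixin (fps R).
HB.instance Definition _ (R : Type) := gen_choiceMixin (fps R).

Lemma fpsP (R : Type) (f g : fps R) :
  (forall n, fps_coef f n = fps_coef g n) -> f = g.
Proof. by case: f g => [f] [g] /= fg; congr FPS; apply/funext. Qed.

Section FPSRing.
Variable R : comNzRingType.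
Implicit Types f g h : fps R.

Definition fps_const (c : R) : fps R := FPS (fun n => if n == 0%N then c else 0).
Definition fps_opp f : fps R := FPS (fun n => - fps_coef f n).
Definition fps_add f g : fps R := FPS (fun n => fps_coef f n + fps_coef g n).
Definition fps_mul f g : fps R :=
  FPS (fun n => \sum_(i < n.+1) fps_coef f i * fps_coef g (n - i)).

Fact fps_addA : associative fps_add.
Proof. by move=> f g h; apply: fpsP => n; exact: addrA. Qed.
Fact fps_addC : commutative fps_add.
Proof. by move=> f g; apply: fpsP => n; exact: addrC. Qed.
Fact fps_add0 : left_id (fps_const 0) fps_add.
Proof. by move=> f; apply: fpsP => n /=; rewrite if_same add0r. Qed.
Fact fps_addN : left_inverse (fps_const 0) fps_opp fps_add.
Proof. by move=> f; apply: fpsP => n /=; rewrite if_same addNr. Qed.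

HB.instance Definition _ :=
  GRing.isZmodule.Build (fps R) fps_addA fps_addC fps_add0 fps_addN.

Let trunc N f : {poly R} := \poly_(i < N.+1) fps_coef f i.

Let truncE N f i : (i <= N)%N -> (trunc N f)`_i = fps_coef f i.
Proof. by move=> iN; rewrite coef_poly ltnS iN. Qed.

Let truncM N f g n : (n <= N)%N ->
  fps_coef (fps_mul f g) n = (trunc N f * trunc N g)`_n.
Proof.
move=> nN; rewrite coefM; apply: eq_bigr => i _.
by rewrite !truncE // ?(leq_trans (leq_subr _ _)) // (leq_trans _ nN) // -ltnS.
Qed.

Fact fps_mulC : commutative fps_mul.
Proof.
by move=> f g; apply: fpsP => n; rewrite !(@truncM n) // [in LHS]mulrC.
Qed.

Fact fps_mulA : associative fps_mul.
Proof.
move=> f g h; apply: fpsP => n.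
transitivity (trunc n f * trunc n g * trunc n h)`_n.
  rewrite -mulrA coefM; apply: eq_bigr => i _.
  by rewrite truncE 1?(@truncM n) ?leq_subr // -ltnS.
rewrite coefM; apply: eq_bigr => i _.
by rewrite (@truncM n) ?truncE ?leq_subr // -ltnS.
Qed.

Fact fps_mul1 : left_id (fps_const 1) fps_mul.
Proof.
move=> f; apply: fpsP => n /=; rewrite big_ord_recl mul1r subn0 big1 ?addr0 //.
by move=> i _; rewrite mul0r.
Qed.

Fact fps_mulDl : left_distributive fps_mul +%R.
Proof.
move=> f g h; apply: fpsP => n /=; rewrite -big_split /=.
by apply: eq_bigr => i _; rewrite mulrDl.
Qed.

Fact fps_one_neq0 : fps_const 1 != 0.
Proof. by apply/eqP => /(congr1 (fun f => fps_coef f 0))/eqP; rewrite oner_eq0. Qed.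

HB.instance Definition _ := GRing.Zmodule_isComNzRing.Build (fps R)
  fps_mulA fps_mulC fps_mul1 fps_mulDl fps_one_neq0.

Definition fps_unit : {pred fps R} := fun f => `[< exists g, g * f = 1 >].
Definition fps_inv f : fps R :=
  if pselect (exists g, g * f = 1) is left fV then projT1 (cid fV) else f.

Fact fps_mulVf : {in fps_unit, left_inverse 1 fps_inv *%R}.
Proof.
move=> f /asboolP fU; rewrite /fps_inv; case: pselect => // fV.
by case: (cid fV).
Qed.

Fact fps_unitP f g : g * f = 1 -> fps_unit f.
Proof. by move=> gf; apply/asboolP; exists g. Qed.

Fact fps_inv_out : {in [predC fps_unit], fps_inv =1 id}.
Proof.
move=> f /asboolPn fN; rewrite /fps_inv; case: pselect => // fV.
Qed.

HB.instance Definition _ := GRing.ComNzRing_hasMulInverse.Build (fps R)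
  fps_mulVf fps_unitP fps_inv_out.

End FPSRing.

(* Over a field, the quotient u / v below is a genuine quotient as soon as v
   has a nonzero constant term. *)
Lemma fps_unitE (K : fieldType) (f : fps K) :
  (f \is a GRing.unit) = (fps_coef f 0 != 0).
Proof.
apply/asboolP/idP => [[g gf]|f0].
  move/(congr1 (fun h => fps_coef h 0)): gf => /= /eqP.
  rewrite big_ord1 /=; apply: contraTneq => ->.
  by rewrite mulr0 eq_sym oner_eq0.
pose step (s : seq K) := rcons s ((fps_coef f 0)^-1 *
  ((size s == 0%N)%:R - \sum_(i < size s) fps_coef f i.+1 * s`_(size s - i.+1))).
pose s n := iter n step [::].
have sizes n : size (s n) = n by elim: n => //= n IH; rewrite size_rcons IH.
have nths n m : (n < m)%N -> (s m)`_n = (s n.+1)`_n.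
  elim: m => // m IH; rewrite ltnS leq_eqVlt => /predU1P[->//|nm].
  by rewrite -IH //= nth_rcons sizes nm.
exists (FPS (fun n => (s n.+1)`_n)); rewrite mulrC; apply: fpsP => n.
change (\sum_(i < n.+1) fps_coef f i * (s (n - i).+1)`_(n - i)
        = (if n == 0%N then 1 else 0)).
rewrite big_ord_recl subn0 [s n.+1]/(step (s n)) /step nth_rcons sizes ltnn eqxx.
rewrite mulrA mulfV // mul1r.
set S := \sum_(i < n) _; set T := \sum_(i < n) _.
suff -> : T = S by rewrite subrK; case: (n == 0%N).
apply: eq_bigr => i _; rewrite -(nths _ n) //.
by rewrite lift0 -subSn // subSS leq_subr.
Qed.

Definition map_fps (R S : Type) (phi : R -> S) (f : fps R) : fps S :=
  FPS (fun n => phi (fps_coef f n)).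

(* e^{a t} *)
Definition fps_exp (K : fieldType) (a : K) : fps K := FPS (fun n => a ^+ n / n`!%:R).

(* Laurent polynomials over R in n variables, i.e. the group algebra R[Z^n];
   << c *g a >> is the term with coefficient c and exponent vector a.
   (The product of {malg R[M]} in monalg is available only for monoids M
   without nontrivial units.) *)
Definition laurent (R : comNzRingType) (n : nat) : Type :=
  {malg R[{ffun 'I_n -> int}]}.

Section LaurentRing.
Variables (R : comNzRingType) (n : nat).
Local Notation expo := {ffun 'I_n -> int}.
Local Notation L := (laurent R n).
Implicit Types f g h : L.

HB.instance Definition _ := GRing.Lmodule.on L.

Definition laurent_one : L := << 1 *g (0 : expo) >>.
Definition laurent_mul f g : L :=
  \sum_(a <- msupp f) \sum_(b <- msupp g) << f@_a * g@_b *g a + b >>.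

Local Notation M := laurent_mul.

Let lmulw (A B : {fset expo}) f g : (msupp f `<=` A)%fset -> (msupp g `<=` B)%fset ->
  M f g = \sum_(a <- A) \sum_(b <- B) << f@_a * g@_b *g a + b >>.
Proof.
move=> fA gB; rewrite /M (big_fset_incl _ fA) /=.
  apply/eq_bigr=> k1 _; apply/big_fset_incl => // k _ /mcoeff_outdom ->.
  by rewrite mulr0 monalgU0.
move=> k _ /mcoeff_outdom fk.
by rewrite big1 // => k' _; rewrite fk mul0r monalgU0.
Qed.

Lemma laurent_mulUU c d (a b : expo) :
  M << c *g a >> << d *g b >> = << c * d *g a + b >>.
Proof. by rewrite (lmulw msuppU_le msuppU_le) !big_seq_fset1 !mcoeffUU. Qed.

Fact laurent_mulC : commutative M.
Proof.
move=> f g; rewrite /M exchange_big; apply: eq_bigr => a _.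
by apply: eq_bigr => b _; rewrite mulrC addrC.
Qed.

Fact laurent_mulDl : left_distributive M +%R.
Proof.
move=> f g h; rewrite (lmulw (msuppD_le f g) (fsubset_refl (msupp h))).
rewrite (lmulw (fsubsetUl _ (msupp g)) (fsubset_refl (msupp h))).
rewrite (lmulw (fsubsetUr (msupp f) _) (fsubset_refl (msupp h))).
rewrite -big_split /=; apply/eq_bigr=> a _.
rewrite -big_split /=; apply/eq_bigr=> b _.
by rewrite mcoeffD mulrDl monalgUD.
Qed.

Let mul0 f : M 0 f = 0.
Proof. by rewrite /M msupp0 big_seq_fset0. Qed.

Let mul_suml I (r : seq I) (F : I -> L) g :
  M (\sum_(i <- r) F i) g = \sum_(i <- r) M (F i) g.
Proof. exact: (big_morph (M^~ g) (fun _ _ => laurent_mulDl _ _ _) (mul0 g)). Qed.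

Let mul_sumr I (r : seq I) (F : I -> L) g :
  M g (\sum_(i <- r) F i) = \sum_(i <- r) M g (F i).
Proof.
by rewrite laurent_mulC mul_suml; apply: eq_bigr => i _; rewrite laurent_mulC.
Qed.

Fact laurent_mulA : associative M.
Proof.
have := laurent_mulUU; have := @mul_sumr; have := @mul_suml.
move: M => m suml sumr mUU f g h.
rewrite (monalgE f) (monalgE g) (monalgE h) !suml; apply: eq_bigr => a _.
rewrite [LHS]sumr [X in _ = m X _]sumr suml; apply: eq_bigr => b _.
rewrite !sumr; apply: eq_bigr => c _.
by rewrite !mUU mulrA addrA.
Qed.

Fact laurent_mul1 : left_id laurent_one M.
Proof.
move=> f; rewrite [in LHS](monalgE f) mul_sumr [RHS]monalgE.
by apply: eq_bigr => a _; rewrite laurent_mulUU mul1r add0r.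
Qed.

Fact laurent_one_neq0 : laurent_one != 0.
Proof. by rewrite monalgU_eq0 oner_eq0. Qed.

HB.instance Definition _ := GRing.Zmodule_isComNzRing.Build L
  laurent_mulA laurent_mulC laurent_mul1 laurent_mulDl laurent_one_neq0.

Fact laurent_scaleAl (c : R) f g : c *: (f * g) = c *: f * g.
Proof.
have scaleU (d : R) (a : expo) : c *: << d *g a >> = << c * d *g a >> :> L.
  by apply/malgP => k; rewrite mcoeffZ !mcoeffU mulrnAr.
rewrite (monalgE f) (monalgE g) mulr_suml !scaler_sumr mulr_suml.
apply: eq_bigr => a _; rewrite mulr_sumr scaler_sumr mulr_sumr.
apply: eq_bigr => b _.
by rewrite scaleU [X in _ *: X]laurent_mulUU [RHS]laurent_mulUU scaleU mulrA.
Qed.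

HB.instance Definition _ := GRing.Lmodule_isLalgebra.Build R L laurent_scaleAl.
HB.instance Definition _ := GRing.Lalgebra_isComAlgebra.Build R L.

Definition laurentX (i : 'I_n) : L := << [ffun j => (j == i)%:Z] >>.

End LaurentRing.

Section Grammar.
Variable F : fieldType.
Local Notation L := (laurent F 4).

Definition var_x : L := laurentX F 0.
Definition var_y : L := laurentX F 1.
Definition var_z : L := laurentX F 2.
Definition var_w : L := laurentX F 3.

(* D is the formal derivative for the grammar
   x -> xy, y -> xz, z -> zw, w -> xz; constants are the c%:A. *)
Record grammar_derivative (D : {linear L -> L}) : Prop := GrammarDerivative {
  grammarM : forall u v, D (u * v) = u * D v + v * D u;
  grammarC : forall c : F, D c%:A = 0;
  grammarx : D var_x = var_x * var_y;
  grammary : D var_y = var_x * var_z;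
  grammarz : D var_z = var_z * var_w;
  grammarw : D var_w = var_x * var_z
}.

(* The conditions above are consistent: they are satisfied by the derivation
   X^a |-> sum_i a_i X^(a - e_i) g_i, with g_i the image of the ith variable. *)
Lemma grammar_derivative_exists :
  exists D : {linear L -> L}, grammar_derivative D.
Proof.
pose g (i : 'I_4) : L := [:: var_x * var_y; var_x * var_z;
                              var_z * var_w; var_x * var_z]`_i.
pose X (a : {ffun 'I_4 -> int}) : L := << a >>.
pose e (i : 'I_4) : {ffun 'I_4 -> int} := [ffun j => (j == i)%:Z].
pose h (a : {ffun 'I_4 -> int}) : L := \sum_i ((a i)%:~R : F) *: (X (a - e i) * g i).
pose D (f : L) : L := mmap (@GRing.in_alg F L) h f.
have ZU c a : c *: X a = << c *g a >>.
  by apply/malgP => k; rewrite mcoeffZ !mcoeffU mulrnAr mulr1.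
have XM a b : X a * X b = X (a + b).
  by rewrite [LHS]laurent_mulUU mulr1.
have DX c a : D << c *g a >> = c *: h a.
  by rewrite /D mmapU mulr_algl.
have Dlin : linear D.
  move=> c u v; rewrite /D raddfD /=; congr (_ + _).
  rewrite (mmapEw (msuppZ_le c u)) /mmap scaler_sumr; apply: eq_bigr => a _.
  by rewrite mcoeffZ !mulr_algl scalerA.
pose lD := GRing.isLinear.Build F L L *:%R D Dlin.
pose LD : {linear L -> L} := HB.pack D lD.
have LDE u : LD u = D u by [].
clearbody LD.
have sumE (u : L) : u = \sum_(a <- msupp u) u@_a *: X a.
  rewrite {1}(monalgE u); apply: eq_bigr => a _; exact: esym (ZU _ _).
have hD a b : h (a + b) = X a * h b + X b * h a.
  rewrite /h !mulr_sumr -big_split /=; apply: eq_bigr => i _.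
  rewrite -!scalerAr !mulrA !XM [a + (b - _)]addrA [b + (a - _)]addrA.
  have -> : (a + b) i = a i + b i by rewrite ffunE.
  by rewrite [b + a]addrC -scalerDl intrD [X in X *: _]addrC.
have DM u v : LD (u * v) = u * LD v + v * LD u.
  rewrite (sumE u) (sumE v); set r := msupp u; set t := msupp v.
  rewrite mulr_suml !linear_sum mulr_suml mulr_sumr -big_split /=.
  apply: eq_bigr => a _.
  rewrite mulr_sumr linear_sum [X in _ = X + _]mulr_sumr.
  rewrite [X in _ = _ + X]mulr_suml -big_split /=.
  apply: eq_bigr => b _.
  rewrite -!(scalerAl, scalerAr) XM !linearZ /= !LDE.
  have DX1 c : D (X c) = h c by rewrite DX scale1r.
  rewrite !DX1 hD !scalerDr -!(scalerAl, scalerAr).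
  by rewrite [v@_b *: (u@_a *: _)]scalerA [v@_b * _]mulrC -scalerA.
have DV i : LD (laurentX F i) = g i.
  rewrite LDE DX scale1r /h (bigD1 i) //= big1 ?addr0; last first.
    by move=> j ji; rewrite ffunE (negPf ji) scale0r.
  by rewrite ffunE eqxx scale1r subrr [X 0](_ : _ = 1) // mul1r.
exists LD; split; rewrite ?DV //.
move=> c; suff D1 : LD 1 = 0 by rewrite linearZ /= D1 scaler0.
rewrite LDE [1]/(X 0) DX scale1r /h big1 // => i _.
by rewrite ffunE scale0r.
Qed.

Definition Gen (D : L -> L) (u : L) : fps L :=
  FPS (fun n => (n`!%:R : F)^-1 *: iter n D u).

End Grammar.

(* Main.v *)
Require Import Defs.
From HB Require Import structures.
From mathcomp Require Import all_boot all_order all_algebra.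
From mathcomp.multinomials Require Import monalg.
From mathcomp Require Import ring.

Set Implicit Arguments.
Unset Strict Implicit.
Unset Printing Implicit Defensive.

Import GRing.Theory.
Local Open Scope ring_scope.

(* Put s = w + y and p = x z.  Since D(s) = 2 p and D(p) = p s, the element
   Delta^2 = s^2 - 4 p is a constant of D.  As Gen is multiplicative and turns D
   into d/dt, the series S = Gen(s) satisfies 2 S' = S^2 - Delta^2.  This
   Riccati equation is linearized by
     V = (S - Delta) (s + Delta) - (S + Delta) (s - Delta) e^(t Delta),
   for which 2 V' = (S + Delta) V and V(0) = 0, so that V = 0.  Solving for S
   and using S = 2 Gen(y) + w - y gives the formula; its
   denominator has constant term 2 Delta, which is nonzero because w^2 has
   coefficient 1 in Delta^2. *)

(** * The formal derivative of a power series *)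

Section FpsDerivative.
Variable R : comNzRingType.
Implicit Types f g : fps R.

Lemma fps_coefD f g n : fps_coef (f + g) n = fps_coef f n + fps_coef g n.
Proof. by []. Qed.

Lemma fps_coefN f n : fps_coef (- f) n = - fps_coef f n.
Proof. by []. Qed.

Lemma fps_coefM f g n :
  fps_coef (f * g) n = \sum_(i < n.+1) fps_coef f i * fps_coef g (n - i).
Proof. by []. Qed.

Lemma fps_coef0M f g : fps_coef (f * g) 0 = fps_coef f 0 * fps_coef g 0.
Proof. by rewrite fps_coefM big_ord1. Qed.

Fact fps_const_zmod_morphism : zmod_morphism (@fps_const R).
Proof. by move=> a b; apply: fpsP => -[|n] //=; rewrite subr0. Qed.

Fact fps_const_monoid_morphism : monoid_morphism (@fps_const R).
Proof.
split=> // a b; apply: fpsP => n; rewrite fps_coefM big_ord_recl /= subn0.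
rewrite big1 ?addr0 => [|i _]; last by rewrite mul0r.
by case: n => //=; rewrite mulr0.
Qed.

HB.instance Definition _ :=
  GRing.isZmodMorphism.Build R (fps R) (@fps_const R) fps_const_zmod_morphism.
HB.instance Definition _ :=
  GRing.isMonoidMorphism.Build R (fps R) (@fps_const R)
    fps_const_monoid_morphism.

Definition fps_deriv f : fps R := FPS (fun n => fps_coef f n.+1 *+ n.+1).

Fact fps_deriv_zmod_morphism : zmod_morphism fps_deriv.
Proof. by move=> f g; apply: fpsP => n; rewrite /= mulrnBl. Qed.

HB.instance Definition _ :=
  GRing.isZmodMorphism.Build (fps R) (fps R) fps_deriv fps_deriv_zmod_morphism.

Lemma fps_derivC c : fps_deriv (fps_const c) = 0.
Proof. by apply: fpsP => n; rewrite /= mul0rn if_same. Qed.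

Lemma fps_derivM f g :
  fps_deriv (f * g) = fps_deriv f * g + f * fps_deriv g.
Proof.
apply: fpsP => n; rewrite [LHS]/= fps_coefD !fps_coefM.
(* The weight [n.+1] splits as [i + (n.+1 - i)]. The first sum then loses its term [i = 0], the
   second its term [i = n.+1]. *)
have -> : (\sum_(i < n.+2) fps_coef f i * fps_coef g (n.+1 - i)) *+ n.+1 =
    \sum_(i < n.+2) (fps_coef f i *+ i) * fps_coef g (n.+1 - i) +
    \sum_(i < n.+2) fps_coef f i * (fps_coef g (n.+1 - i) *+ (n.+1 - i)).
  rewrite -sumrMnl -big_split; apply: eq_bigr => i _ /=.
  by rewrite mulrnAl mulrnAr -mulrnDr subnKC // -ltnS.
congr (_ + _).
  by rewrite big_ord_recl mulr0n mul0r add0r.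
rewrite big_ord_recr /= subnn mulr0n mulr0 addr0.
by apply: eq_bigr => i _ /=; rewrite subSn // -ltnS.
Qed.

End FpsDerivative.

(** * Differential equations for power series in characteristic 0 *)

Section FpsOde.
Variable K : fieldType.
Hypothesis K_char0 : [pchar K] =i pred0.

Lemma invf_factS n : (n.+1`!%:R : K)^-1 *+ n.+1 = n`!%:R^-1.
Proof.
rewrite factS natrM invfM -mulrnAl -mulr_natr mulVf ?mul1r //.
by rewrite (pcharf0P K).1.
Qed.

Lemma fps_coef_deriv_inj (f g : fps K) n :
  fps_coef (fps_deriv f) n = fps_coef (fps_deriv g) n ->
  fps_coef f n.+1 = fps_coef g n.+1.
Proof.
move=> /eqP; rewrite -subr_eq0 -mulrnBl -mulr_natr mulf_eq0.
by rewrite (pcharf0P K).1 // orbF subr_eq0 => /eqP.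
Qed.

Lemma fps_deriv_exp (a : K) :
  fps_deriv (fps_exp a) = fps_const a * fps_exp a.
Proof.
apply: fpsP => n; rewrite fps_coefM big_ord_recl big1 ?addr0 => [|i _].
  by rewrite /= subn0 -mulrnAr invf_factS exprS mulrA.
by rewrite /= mul0r.
Qed.

(** Coefficient [n] of the equation expresses [n.+1] times the next coefficient of [v] through the
    earlier ones, so all vanish by strong induction. *)
Lemma fps_linear_ode0 (b v : fps K) :
  fps_deriv v = b * v -> fps_coef v 0 = 0 -> v = 0.
Proof.
move=> dv v0; apply: fpsP; elim/ltn_ind => -[//|n] IHn.
apply: fps_coef_deriv_inj; rewrite dv fps_coefM [RHS]mul0rn big1 // => i _.
by rewrite IHn ?ltnS ?leq_subr //= if_same mulr0.
Qed.

(** The solution is left in cross-multiplied form, so that no invertibility is required here. *)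
Lemma fps_riccati (f : fps K) (a c : K) :
  2%:R * fps_deriv f = f ^+ 2 - fps_const a ^+ 2 -> fps_coef f 0 = c ->
  (f - fps_const c)
    * (fps_const (c + a) - fps_const (c - a) * fps_exp a)
  = fps_const (c ^+ 2 - a ^+ 2) * (fps_exp a - 1).
Proof.
move=> df f0; set E := fps_exp a.
pose d := fps_const a; pose s := fps_const c.
have half : fps_const 2%:R^-1 * 2%:R = 1 :> fps K.
  by rewrite -(rmorph_nat (@fps_const K)) -rmorphM mulVf ?rmorph1 ?(pcharf0P K).1.
have V0 : (f - d) * (s + d) - (f + d) * (s - d) * E = 0.
  apply: (fps_linear_ode0 (b := fps_const 2%:R^-1 * (f + d))); last first.
    rewrite fps_coefD fps_coefN !fps_coef0M !fps_coefD !fps_coefN f0 /=.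
    by rewrite expr0 divr1; ring.
  (* Writing 1 as [2^-1 * 2] produces the factor [2%:R * fps_deriv f] to which [df] applies. *)
  rewrite -[LHS]mul1r -half -!mulrA; congr (_ * _).
  have dB (g h : fps K) : fps_deriv (g - h) = fps_deriv g - fps_deriv h.
    exact: raddfB.
  have dD (g h : fps K) : fps_deriv (g + h) = fps_deriv g + fps_deriv h.
    exact: raddfD.
  rewrite dB !fps_derivM dB dD dD dB !fps_derivC fps_deriv_exp -/E -/d.
  transitivity (2%:R * fps_deriv f * (s + d - (s - d) * E)
    - 2%:R * (f + d) * (s - d) * (d * E)); first by ring.
  by rewrite df -/d; ring.
transitivity ((f - d) * (s + d) - (f + d) * (s - d) * E
    + (s ^+ 2 - d ^+ 2) * (E - 1)); first by rewrite /s /d; ring.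
by rewrite V0 add0r /s /d; ring.
Qed.

End FpsOde.

(** * Generating functions for the grammar *)

Section Grammar.
Variable F : fieldType.
Hypothesis F_char0 : [pchar F] =i pred0.
Variables (A : comAlgType F) (D : {linear A -> A}).
Hypothesis DM : forall u v, D (u * v) = u * D v + v * D u.
Variables (K : fieldType) (iota : {rmorphism A -> K}).

Lemma codomain_pchar0 : [pchar K] =i pred0.
Proof.
by move=> p; rewrite (fmorph_pchar (iota \o @GRing.in_alg F A)) F_char0.
Qed.
Let K_char0 := codomain_pchar0.

Lemma iterD n (u v : A) : iter n D (u + v) = iter n D u + iter n D v.
Proof. by elim: n => //= n ->; rewrite raddfD. Qed.

(** The image of [Gen D u] over the field [K], where [Delta] lives and the quotient makes sense. *)
Definition iGen (u : A) : fps K :=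
  FPS (fun n => iota ((n`!%:R : F)^-1 *: iter n D u)).

Lemma iGenD u v : iGen (u + v) = iGen u + iGen v.
Proof. by apply: fpsP => n; rewrite /= iterD scalerDr rmorphD. Qed.

Lemma iGen_coef0 u : fps_coef (iGen u) 0 = iota u.
Proof. by rewrite /= invr1 scale1r. Qed.

Lemma iGen_deriv u : fps_deriv (iGen u) = iGen (D u).
Proof.
apply: fpsP => n; rewrite /= -rmorphMn scalerMnl -iterSr iterS.
by rewrite invf_factS.
Qed.

Lemma iGen_constant u : D u = 0 -> iGen u = fps_const (iota u).
Proof.
move=> Du; apply: fpsP => -[|n]; first exact: iGen_coef0.
rewrite /= -iterS iterSr Du.
have -> : iter n D 0 = 0 by elim: n => //= n ->; rewrite raddf0.
by rewrite scaler0 raddf0.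
Qed.

(** By the Leibniz rules for [D] and for series, the derivatives of both sides are sums of instances
    of the same claim, for [u, D v] and [v, D u]. Hence the induction on the coefficient keeps [u]
    and [v] general. *)
Lemma iGenM u v : iGen (u * v) = iGen u * iGen v.
Proof.
apply: fpsP => n; elim: n u v => [|n IHn] u v.
  by rewrite fps_coef0M !iGen_coef0 rmorphM.
apply: fps_coef_deriv_inj; rewrite // fps_derivM !iGen_deriv DM iGenD.
by rewrite addrC mulrC !fps_coefD !IHn.
Qed.

Variables x y z w : A.
Hypotheses (Dx : D x = x * y) (Dy : D y = x * z).
Hypotheses (Dz : D z = z * w) (Dw : D w = x * z).

(** Both terms have derivative [4 x z (w + y)]. *)
Lemma grammar_discriminant : D ((w + y) * (w + y) - (x * z) *+ 4) = 0.
Proof. by rewrite raddfB raddfMn /= !DM !raddfD /= Dw Dy Dx Dz; ring. Qed.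

Lemma iGen_y (Delta : K) : Delta != 0 ->
  Delta ^+ 2 = (iota w + iota y) ^+ 2 - 4%:R * iota x * iota z ->
  iGen y = fps_const (iota y) +
  (fps_const (- 2%:R * iota x * iota z)
   + fps_const (2%:R * iota x * iota z) * fps_exp Delta) /
  (fps_const (iota w + iota y + Delta)
   - fps_const (iota w + iota y - Delta) * fps_exp Delta).
Proof.
move=> Delta_neq0 Delta2.
have two_neq0 : 2%:R != 0 :> K by rewrite (pcharf0P K).1.
set E := fps_exp Delta; set M := _ - _ * E.
have M_unit : M \is a GRing.unit.
  rewrite fps_unitE fps_coefD fps_coefN fps_coef0M /= divr1 expr0 mulr1.
  have -> : iota w + iota y + Delta - (iota w + iota y - Delta) = 2%:R * Delta.
    by ring.
  by rewrite mulf_neq0.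
have twoU : (2%:R : fps K) \is a GRing.unit.
  by rewrite -(rmorph_nat (@fps_const K)) rmorph_unit ?unitfE.
pose S := iGen (w + y).
have S0 : fps_coef S 0 = iota w + iota y by rewrite iGen_coef0 rmorphD.
(* Since [D w = D y], the element [w - y] is a constant of [D]. *)
have SY : S = 2%:R * iGen y + fps_const (iota w - iota y).
  have -> : S = iGen (w - y) + iGen y + iGen y by rewrite -!iGenD subrK.
  rewrite [iGen (w - y)]iGen_constant ?raddfB; last by rewrite /= Dw Dy subrr.
  by rewrite /=; ring.
have S_deriv : fps_deriv S = 2%:R * iGen (x * z).
  by rewrite iGen_deriv // raddfD /= Dw Dy iGenD mulr_natl mulr2n.
have S2 : S ^+ 2 = 4%:R * iGen (x * z) + fps_const Delta ^+ 2.
  have -> : fps_const Delta ^+ 2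
      = iGen ((w + y) * (w + y) - (x * z) *+ 4).
    rewrite (iGen_constant grammar_discriminant) -rmorphXn Delta2 /=.
    by congr fps_const; ring.
  have -> : 4%:R * iGen (x * z) = iGen ((x * z) *+ 4).
    by rewrite !mulrS !mulr0n !addr0 !iGenD; ring.
  by rewrite expr2 -iGenM -iGenD; congr iGen; ring.
have dS : 2%:R * fps_deriv S = S ^+ 2 - fps_const Delta ^+ 2.
  by rewrite S_deriv S2 addrK mulrA -natrM.
suff YM : (iGen y - fps_const (iota y)) * M
    = fps_const (- 2%:R * iota x * iota z)
      + fps_const (2%:R * iota x * iota z) * E.
  by rewrite -YM mulrK // addrC subrK.
(* Doubling turns [iGen y - y] into [S - (w + y)]. The Riccati solution then has right-hand side
   [4 x z (E - 1)], twice the numerator. *)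
apply: (mulrI twoU).
transitivity ((S - fps_const (iota w + iota y)) * M).
  by rewrite SY; ring.
by rewrite (fps_riccati K_char0 dS S0) Delta2 -/E; ring.
Qed.

End Grammar.

Lemma discriminant_neq0 (F : fieldType) :
  (var_w F + var_y F) ^+ 2 - 4%:R * var_x F * var_z F != 0.
Proof.
pose m : {ffun 'I_4 -> int} := [ffun j => (j == 3)%:Z] + [ffun j => (j == 3)%:Z].
apply/eqP => /(congr1 (fun u : laurent F 4 => u@_m)).
have -> : (var_w F + var_y F) ^+ 2 - 4%:R * var_x F * var_z F =
    var_w F * var_w F + (var_w F * var_y F) *+ 2 + var_y F * var_y F
    - (var_x F * var_z F) *+ 4 by ring.
have XM i j : laurentX F i * laurentX F j =
    << [ffun k : 'I_4 => (k == i)%:Z] + [ffun k => (k == j)%:Z] >>.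
  by rewrite [LHS]laurent_mulUU mulr1.
rewrite !XM mcoeff0 mcoeffB !mcoeffD !mcoeffU eqxx.
(* If the second factor is not [w], the exponent of [w] in the product is at most 1, whereas it is 2
   in [m]. *)
have ne (i j : 'I_4) : j != 3 ->
    ([ffun k : 'I_4 => (k == i)%:Z] + [ffun k => (k == j)%:Z] == m) = false.
  move=> j3; apply/eqP => /ffunP/(_ 3); rewrite !ffunE eqxx.
  by rewrite [3 == j]eq_sym (negPf j3); case: (_ == i).
by rewrite !ne // !mulr0n !addr0 subr0 => /eqP; rewrite oner_eq0.
Qed.

Theorem theorem3p4
  (F : fieldType) (F_char0 : [pchar F] =i pred0)
  (D : {linear laurent F 4 -> laurent F 4}) (D_grammar : grammar_derivative D)
  (K : fieldType) (iota : {rmorphism laurent F 4 -> K})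
  (iota_inj : injective iota)
  (Delta : K) :
  let x := iota (var_x F) in
  let y := iota (var_y F) in
  let z := iota (var_z F) in
  let w := iota (var_w F) in
  Delta ^+ 2 = (w + y) ^+ 2 - 4%:R * x * z ->
  map_fps iota (Gen D (var_y F)) =
  fps_const y +
  (fps_const (- 2%:R * x * z) + fps_const (2%:R * x * z) * fps_exp Delta) /
  (fps_const (w + y + Delta) - fps_const (w + y - Delta) * fps_exp Delta).

Proof.
move=> x y z w Delta2.
have Delta_neq0 : Delta != 0.
  (* Injectivity of [iota] carries the nonvanishing of the discriminant over to [Delta ^+ 2] in
     [K]. *)
  have := discriminant_neq0 F; rewrite -(inj_eq iota_inj) rmorph0.
  rewrite rmorphB rmorphXn rmorphD !rmorphM rmorph_nat -Delta2.
  by rewrite expf_eq0.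
case: D_grammar => DM _ Dx Dy Dz Dw.
exact: (iGen_y F_char0 DM Dx Dy Dz Dw Delta_neq0 Delta2).
Qed.
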